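(* Let $S$ be a star with central vertex $c$, let $\lambda$ be a 1-labeling of $S$, and let $X$ be a maximum-size set of leaves of $S$ such that $\lambda(cu)\neq\lambda(cv)$ for all distinct $u,v\in X$. Then the set $V(S)\setminus X$ is a minimum-size temporal resolving set of the temporal graph $(S,\lambda)$.
   Context: A temporal graph $(G,\lambda)$ consists of a finite simple undirected graph $G=(V,E)$ (the underlying graph) and a time labeling $\lambda$ assigning to each edge $e\in E$ a nonempty finite set $\lambda(e)$ of positive integers (the time-steps at which $e$ is present). $\lambda$ is a 1-labeling if $|\lambda(e)|\le 1$ (hence $=1$) for every edge. A journey from $u$ to $v$ is a path in the underlying graph from $u$ to $v$ together with a choice, for each edge of the path, of a time-step in its label set so that the chosen time-steps are strictly increasing along the path. The temporal distance $\mathrm{dist}_t(u,v)$ is the smallest time-step at which a journey from $u$ reaches $v$ (with $\mathrm{dist}_t(u,u)=0$, and $\mathrm{dist}_t(u,v)=\infty$ if there is no journey from $u$ to $v$). A vertex $v$ is reachable from $u$ if there is a journey from $u$ to $v$ (every vertex is reachable from itself). A set $R\subseteq V$ is a temporal resolving set if (i) every $v\in V$ is reachable from some $s\in R$, and (ii) for every two distinct $u,v\in V$ there is $s\in R$ with $\mathrm{dist}_t(s,u)\neq \mathrm{dist}_t(s,v)$. *)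

(* Defs.v *)
(* Mathematical Components, with classical logic from mathcomp.classical.boolp
   used only to define the temporal distance. *)
From mathcomp Require Import all_boot finmap boolp.

Set Implicit Arguments.
Unset Strict Implicit.
Unset Printing Implicit Defensive.

(* Edges are two-element sets of vertices. The labeling is a total function on
   sets of vertices; its values outside of [edges] are irrelevant. *)
Record temporal_graph := TemporalGraph {
  vertex :> finType;
  edges : {set {set vertex}};
  label : {set vertex} -> {fset nat};
  edges_card2 : forall e, e \in edges -> #|e| = 2;
  label_neq0 : forall e, e \in edges -> label e != fset0;
  label_gt0 : forall e t, e \in edges -> t \in label e -> 0 < t
}.

Definition one_labeling (G : temporal_graph) : Prop :=
  forall e, e \in edges G -> #|` label e| <= 1.

(* A journey from [u] is the sequence of its steps (w, t): the next vertex w of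
   the path, and the time-step t at which the edge leading to w is crossed.
   The time 0 paired with [u] is a dummy that no condition refers to. *)
Definition step (G : temporal_graph) : rel (G * nat) :=
  fun a b => ([set a.1; b.1] \in edges G) && (b.2 \in label [set a.1; b.1]).

Definition journey (G : temporal_graph) (u v : G) (p : seq (G * nat)) : bool :=
  [&& path (@step G) (u, 0) p, uniq (u :: unzip1 p),
      last u (unzip1 p) == v & sorted ltn (unzip2 p)].

(* The empty journey arrives at time 0. *)
Definition arrival (G : temporal_graph) (p : seq (G * nat)) : nat :=
  last 0 (unzip2 p).

Definition reachable (G : temporal_graph) (u v : G) : Prop :=
  exists p, journey u v p.

Definition reaches_at (G : temporal_graph) (u v : G) (t : nat) : Prop :=
  exists2 p, journey u v p & arrival p = t.

(* [None] is the infinite distance. *)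
Definition dist_t (G : temporal_graph) (u v : G) : option nat :=
  if pselect (exists t, `[< reaches_at u v t >]) is left ex_t
  then Some (ex_minn ex_t) else None.

Lemma dist_t_refl (G : temporal_graph) (u : G) : dist_t u u = Some 0.
Proof.
have r0 : `[< reaches_at u u 0 >].
  by apply/asboolP; exists [::]; rewrite // /journey /= eqxx.
rewrite /dist_t; case: pselect => [ex_t|[]]; last by exists 0.
by case: ex_minnP => t _ /(_ _ r0); rewrite leqn0 => /eqP ->.
Qed.

Definition resolving (G : temporal_graph) (R : {set G}) : Prop :=
  (forall v : G, exists2 s, s \in R & reachable s v) /\
  (forall u v : G, u != v -> exists2 s, s \in R & dist_t s u != dist_t s v).

Definition minimum_resolving (G : temporal_graph) (R : {set G}) : Prop :=
  resolving R /\ forall R' : {set G}, resolving R' -> #|R| <= #|R'|.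

(* The leaves of a star are its non-central vertices: when there is only one of
   them, the center also has degree one but does not count as a leaf. *)
Definition leaves (G : temporal_graph) (c : G) : {set G} := [set~ c].

Definition is_star (G : temporal_graph) (c : G) : Prop :=
  edges G = [set [set c; u] | u in leaves c].

Definition distinctly_labeled (G : temporal_graph) (c : G) (X : {set G}) : Prop :=
  X \subset leaves c /\
  {in X &, forall u v, u != v -> label [set c; u] != label [set c; v]}.

Definition maximum_distinctly_labeled (G : temporal_graph) (c : G)
    (X : {set G}) : Prop :=
  distinctly_labeled c X /\
  forall Y : {set G}, distinctly_labeled c Y -> #|Y| <= #|X|.

(* Main.v *)
(* In a star, a journey to a leaf u from another vertex s either crosses the
   edge cu alone (s = c) or first crosses cs (which needs a smaller label), so
   its arrival time is the label of cu.  Hence two leaves with the same label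
   are separated only by themselves, and the leaves outside a resolving set are
   distinctly labeled.  If the center is also outside, then a leaf of minimum
   label in the resolving set can be added to them: by reachability, its label
   is smaller than that of every leaf outside. *)
Require Import Defs.
From mathcomp Require Import all_boot finmap boolp.

Set Implicit Arguments.
Unset Strict Implicit.
Unset Printing Implicit Defensive.

Section TemporalDistance.
Variable G : temporal_graph.
Implicit Types u v w : G.

Lemma dist_t_reaches u v t : dist_t u v = Some t -> reaches_at u v t.
Proof.
rewrite /dist_t; case: pselect => // ex_t [<-].
by case: ex_minnP => n /asboolP.
Qed.

Lemma reaches_dist_t u v t :
  reaches_at u v t -> exists2 t', dist_t u v = Some t' & reaches_at u v t'.
Proof.
move=> /asboolP rt; case E: (dist_t u v) => [t'|].
  by exists t' => //; apply: dist_t_reaches.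
by move: E; rewrite /dist_t; case: pselect => // -[]; exists t.
Qed.

(** [dist_t u v] depends on [v] only through the predicate [reaches_at u v], so extensionality
    suffices and no minima are compared. *)
Lemma eq_dist_t u v w :
  (forall t, reaches_at u v t <-> reaches_at u w t) -> dist_t u v = dist_t u w.
Proof.
move=> eq_r; rewrite /dist_t; have -> // : reaches_at u v = reaches_at u w.
by apply/funext => t; apply/propext.
Qed.

(** Labels are positive and times increase along a journey, so any nonempty journey arrives after
    time 0. *)
Lemma reaches_at0 u v : reaches_at u v 0 -> u = v.
Proof.
case; case=> [|[w t] p] /and4P[/= p_path _ /eqP //].
rewrite /arrival /= => _ sort_p last0.
have /andP[e_w lab_w] : step (u, 0) (w, t) by case/andP: p_path.
have t_gt0 := label_gt0 e_w lab_w.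
have /allP le_t : all (leq t) (unzip2 p).
  have := order_path_min ltn_trans sort_p.
  by apply: sub_all => k /ltnW.
suff: t <= last t (unzip2 p) by rewrite last0 leqNgt t_gt0.
have := mem_last t (unzip2 p).
by rewrite inE => /orP[/eqP->|/le_t].
Qed.

Lemma dist_t_eq0 u v : dist_t u v = Some 0 -> u = v.
Proof. by move/dist_t_reaches/reaches_at0. Qed.

End TemporalDistance.

Section Star.
Variables (S : temporal_graph) (c : S).
Hypotheses (starS : is_star c) (lab1 : one_labeling S).
Implicit Types (s u v : S) (t : nat) (R X : {set S}).

(* Meaningless at the center itself. *)
Definition spoke_time u : nat := head 0 (label [set c; u]).

Lemma spoke u : u != c -> [set c; u] \in edges S.
Proof. by move=> uc; rewrite starS; apply/imsetP; exists u; rewrite ?inE. Qed.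

Lemma label_spoke u : u != c -> label [set c; u] = [fset spoke_time u]%fset.
Proof.
move=> uc; have e_u := spoke uc.
have := lab1 e_u; have := label_neq0 e_u.
rewrite -cardfs_gt0 => gt0 le1.
have /cardfs1P[t lab_t] : #|` label [set c; u]| == 1 by rewrite eqn_leq le1.
have : spoke_time u \in label [set c; u].
  (* The default of [head] would occur only for an empty label, which [gt0] excludes. *)
  move: gt0; rewrite /spoke_time -[_ \in _]/(_ \in enum_fset _).
  by case: (enum_fset _) => //= a l _; rewrite inE eqxx.
by rewrite lab_t inE => /eqP ->.
Qed.

Lemma edge_star u v : [set u; v] \in edges S -> u != v /\ (u = c \/ v = c).
Proof.
move=> e_uv; have := edges_card2 e_uv; rewrite cards2; case: eqVneq => // _ _.
split=> //; move: e_uv; rewrite starS => /imsetP[w _ e_w].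
by have := set21 c w; rewrite -e_w !inE => /orP[] /eqP <-; [left | right].
Qed.

Lemma step_from_center u i t : u != c -> step (c, i) (u, t) = (t == spoke_time u).
Proof. by move=> uc; rewrite /step /= spoke //= label_spoke // inE. Qed.

Lemma step_to_center u i t : u != c -> step (u, i) (c, t) = (t == spoke_time u).
Proof. by move=> uc; rewrite /step /= setUC spoke //= label_spoke // inE. Qed.

(** Every edge contains [c] and a journey visits [c] at most once, so a journey has at most two
    steps. The case [s = c] stands apart because [spoke_time c] has no meaning. *)
Lemma reaches_leafP s u t : u != c -> s != u ->
  reaches_at s u t <->
  t = spoke_time u /\ (s = c \/ spoke_time s < spoke_time u).
Proof.
move=> uc su; split; last first.
  case=> ->; case: (eqVneq s c) => [-> _|sc [/eqP|lt_su]].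
  - exists [:: (u, spoke_time u)] => //.
    by rewrite /journey /= step_from_center // !eqxx inE eq_sym uc.
  - by rewrite (negPf sc).
  exists [:: (c, spoke_time s); (u, spoke_time u)] => //.
  rewrite /journey /= step_to_center // step_from_center // !eqxx !inE.
  by rewrite negb_or sc su eq_sym uc lt_su.
case=> p + <-; case: p => [|[a i] p].
  by rewrite /journey /= (negPf su).
case: p => [|[b j] p] /and4P[/=].
  rewrite andbT => sa _ /eqP au _; subst a; rewrite /arrival /=.
  case/andP: (sa) => /edge_star[_ [/= sc|/= uc']] _; last first.
    by rewrite uc' eqxx in uc.
  by subst s; move: sa; rewrite step_from_center // => /eqP ->; split=> //; left.
case/and3P=> sa ab path_p; rewrite !inE !negb_or.
case/and4P=> /and3P[s_a s_b _] /andP[a_b a_p] b_p uniq_p last_p.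
case/andP=> lt_ij sort_p.
(* The first two edges both contain [c]: if [a] were not [c], both [s] and [b] would be. *)
have ac : a = c.
  case/andP: (sa) => /edge_star[/= _ [sc|//]] _.
  case/andP: (ab) => /edge_star[/= _ [//|bc]] _.
  by rewrite sc bc eqxx in s_b.
subst a; have bc : b != c by rewrite eq_sym.
case: p path_p a_p last_p {b_p uniq_p sort_p} => [|[d k] p] /= path_p.
  move=> _ /eqP bu; subst b; rewrite /arrival /=.
  move: sa ab lt_ij; rewrite step_to_center // step_from_center //.
  by move=> /eqP -> /eqP ->; split=> //; right.
(* A third step would leave the leaf [b] and so return to [c], already visited. *)
case/andP: path_p => /andP[/edge_star[/= _ [bc'|->]] _] _.
  by rewrite bc' eqxx in bc.
by rewrite inE eqxx.
Qed.

Lemma reachable_leaf s u : u != c -> s != u ->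
  reachable s u -> s = c \/ spoke_time s < spoke_time u.
Proof.
move=> uc su [p jp].
have : reaches_at s u (arrival p) by exists p.
by case/(reaches_leafP _ uc su).
Qed.

Lemma reaches_center u : u != c -> reaches_at c u (spoke_time u).
Proof.
by move=> uc; apply/reaches_leafP; rewrite // 1?eq_sym //; split; [|left].
Qed.

Lemma dist_center u : u != c -> dist_t c u = Some (spoke_time u).
Proof.
move=> uc; have [t -> rt] := reaches_dist_t (reaches_center uc).
have cu : c != u by rewrite eq_sym.
by case/(reaches_leafP _ uc cu): rt => ->.
Qed.

Lemma distinctly_labeledP X :
  distinctly_labeled c X <-> c \notin X /\ {in X &, injective spoke_time}.
Proof.
have leafP : X \subset leaves c <-> c \notin X.
  by rewrite /leaves subsetC sub1set inE.
split=> -[/leafP cX inj_X]; split=> // u v uX vX; last first.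
  have uc : u != c by apply: contraNneq (iffLR leafP cX) => <-.
  have vc : v != c by apply: contraNneq (iffLR leafP cX) => <-.
  by apply: contra_neq; rewrite !label_spoke // => /fset1_inj/(inj_X _ _ uX vX).
move=> eq_t; apply/eqP; apply: contraT => /(inj_X _ _ uX vX).
by rewrite !label_spoke ?eq_t ?eqxx //; apply: contraNneq cX => <-.
Qed.

(** A vertex outside [X] separates itself from all others, being the only one at distance 0 from
    itself. The center reaches everything and separates the vertices of [X] by their spoke times. *)
Lemma setC_distinctly_labeled_resolving X :
  distinctly_labeled c X -> resolving (~: X).
Proof.
case/distinctly_labeledP=> cX inj_X; have cR : c \in ~: X by rewrite inE.
split=> [v|u v uv].
  exists c => //; case: (eqVneq v c) => [->|vc].
    by exists [::]; rewrite /journey /= eqxx.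
  by have [p jp _] := reaches_center vc; exists p.
case uX: (u \in X); last first.
  exists u; rewrite ?inE ?uX // dist_t_refl.
  by apply: contraNneq uv => /esym/dist_t_eq0 ->.
case vX: (v \in X); last first.
  exists v; rewrite ?inE ?vX // dist_t_refl.
  by apply: contraNneq uv => /dist_t_eq0 ->.
exists c => //; rewrite !dist_center; first last.
- by apply: contraTneq uX => ->.
- by apply: contraTneq vX => ->.
by apply: contraNneq uv => -[/(inj_X _ _ uX vX) ->].
Qed.

Lemma resolving_spoke_inj R :
  resolving R -> {in ~: R :\ c &, injective spoke_time}.
Proof.
case=> _ resR u v; rewrite !inE => /andP[uc uR] /andP[vc vR] eq_t.
apply/eqP; apply: contraT => /resR[s sR /eqP[]].
have su : s != u by apply: contraNneq uR => <-.
have sv : s != v by apply: contraNneq vR => <-.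
(* Since [s] is neither [u] nor [v], [reaches_leafP] describes the arrival times at each leaf by its
   spoke time alone. *)
apply: eq_dist_t => t.
by split=> /reaches_leafP-/(_ _ _)[] // -> h; apply/reaches_leafP => //;
  rewrite -?eq_t // ?eq_t.
Qed.

Lemma resolving_cardC R : resolving R ->
  exists2 Y : {set S}, distinctly_labeled c Y & #|~: R| <= #|Y|.
Proof.
move=> resR; have inj_R := resolving_spoke_inj resR.
case: (boolP (c \in R)) => cR.
  have eqR : ~: R :\ c = ~: R.
    by apply/setDidPl; rewrite disjoint_sym disjoints1 inE cR.
  exists (~: R) => //; apply/distinctly_labeledP; rewrite inE cR.
  by split=> //; rewrite -eqR.
(* Some member of [R] must reach [c]; hence [R] is nonempty and [spoke_time] has a minimizer [s] on
   it. *)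
have [reach _] := resR; have [s0 s0R _] := reach c.
case: (arg_minnP spoke_time s0R) => s; rewrite -/(s \in R) => sR s_min.
have sc : s != c by apply: contraNneq cR => <-.
have lt_s u : u \in ~: R :\ c -> spoke_time s < spoke_time u.
  rewrite !inE => /andP[uc uR]; have [r rR r_u] := reach u.
  have ru : r != u by apply: contraNneq uR => <-.
  case: (reachable_leaf uc ru r_u) => [rc|]; first by rewrite -rc rR in cR.
  by apply: leq_ltn_trans; apply: s_min.
(* Exchanging [c] for [s], which lies in [R], preserves the cardinality of [~: R]. *)
exists (s |: ~: R :\ c); last first.
  by rewrite (cardsD1 c (~: R)) cardsU1 !inE cR sR andbF.
apply/distinctly_labeledP; split; first by rewrite !inE eqxx eq_sym (negPf sc).
move=> u v /setU1P[->|uR] /setU1P[->|vR] // eq_t; last exact: inj_R.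
- by have := lt_s v vR; rewrite eq_t ltnn.
by have := lt_s u uR; rewrite eq_t ltnn.
Qed.

End Star.

Theorem theorem8 (S : temporal_graph) (c : S) (X : {set S})
    (starS : is_star c) (lab1 : one_labeling S)
    (maxX : maximum_distinctly_labeled c X) :
  minimum_resolving (~: X).
Proof.
case: maxX => dlX maxX.
split=> [|R /(resolving_cardC starS lab1)[Y /maxX leYX leRY]].
  exact: setC_distinctly_labeled_resolving starS lab1 _ dlX.
(* The bound of [#|~: R|] by [#|X|] becomes the desired one on passing to complements. *)
have := leq_trans leRY leYX.
by rewrite -(leq_add2l #|R|) cardsC -(cardsC X) addnC leq_add2r.
Qed.
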